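(* Let $(X,d)$ be a Hadamard space, let $A \subset X$ be a nonempty finite set, and let $\bar x \in X \setminus A$. Define $f_{A,\bar x} \colon X \to \mathbb{R}$ by $f_{A,\bar x}(x) = \frac{1}{2}\max_{a \in A}\{ d(a,x)^2 - d(a,\bar x)^2 \}$. Then $$|\nabla f_{A,\bar x}|(\bar x) \ \ge\ \mathrm{def}_A(\bar x).$$ If moreover $X$ is locally compact and has the geodesic extension property, then equality holds, and furthermore the supremum $\sup_{y \ne \bar x} \min_{a \in A} \{ d(a,\bar x)\cos\angle a\bar x y\}$ in the definition of $\mathrm{def}_A(\bar x)$ is attained.
   Context: A Hadamard space is a complete CAT(0) geodesic space. $\angle a x y$ denotes the Alexandrov angle at $x$ between the geodesic segments $[x,a]$ and $[x,y]$. For $\alpha \in \mathbb{R}$ write $\alpha^+ = \max\{\alpha,0\}$. For a nonempty finite set $A \subset X$, the mean deficit at a point $x \in X\setminus A$ is $$\mathrm{def}_A(x) = \Big( \sup_{y \in X,\, y \ne x}\ \min_{a \in A} \{ d(a,x) \cos\angle a x y \} \Big)^+ .$$ For a function $f \colon X \to \mathbb{R}$ and a point $\bar x \in X$, the slope $|\nabla f|(\bar x)$ is zero if $\bar x$ is a local minimizer of $f$, and otherwise is $\limsup_{x \to \bar x,\, x\neq \bar x} \frac{f(\bar x) - f(x)}{d(\bar x,x)}$. A geodesic space has the geodesic extension property if every local geodesic $c \colon [\alpha,\beta] \to X$ with $\alpha<\beta$ extends to a local geodesic $[\alpha,\beta+\epsilon] \to X$ for some $\epsilon>0$; in a Hadamard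 space this is equivalent to every nonconstant geodesic segment extending to a geodesic line $\mathbb{R} \to X$. *)

(* Defs.v *)
From mathcomp Require Export all_boot all_order all_algebra finmap.
From mathcomp Require Export all_classical all_reals all_analysis.
Export Order.TTheory GRing.Theory Num.Theory.
Export numFieldTopology.Exports numFieldNormedType.Exports.

Set Implicit Arguments.
Unset Strict Implicit.
Unset Printing Implicit Defensive.

Local Open Scope classical_set_scope.
Local Open Scope ring_scope.

Section Hadamard.
Context {R : realType} {X : metricType R}.
Implicit Types (c : R -> X) (x y z a : X).

(* Same content as the library's completeType, whose carrier is pointed and
   which has no join with metricType. *)
Definition complete_space :=
  forall F : set_system X, ProperFilter F -> cauchy F -> exists x : X, F --> x.

(* A path [0, d(x, y)] -> X is encoded as a function on the whole line whose
   values outside the interval are irrelevant. *)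
Definition geodesic c x y :=
  [/\ c 0 = x, c (mdist x y) = y &
      forall s t, 0 <= s <= mdist x y -> 0 <= t <= mdist x y ->
        mdist (c s) (c t) = `|s - t|].

Definition geodesic_space := forall x y, exists c, geodesic c x y.

Definition edist (p q : 'rV[R]_2) : R :=
  Num.sqrt (\sum_(i < 2) (p 0 i - q 0 i) ^+ 2).

Definition comparison_triangle x y z (x' y' z' : 'rV[R]_2) :=
  [/\ edist x' y' = mdist x y, edist x' z' = mdist x z
    & edist y' z' = mdist y z].

(* The point at distance s from x' on the segment [x', y'] of length l. *)
Definition comparison_point (x' y' : 'rV[R]_2) (l s : R) : 'rV[R]_2 :=
  x' + (s / l) *: (y' - x').

(* Two points of a geodesic triangle lie on two sides with a common vertex,
   called x here; comparing two points of the same side is the case y = z,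
   c = c'.  The third side exists in a geodesic space and does not enter the
   inequality. *)
Definition cat0_inequality :=
  forall x y z c c', geodesic c x y -> geodesic c' x z ->
  forall x' y' z' : 'rV[R]_2, comparison_triangle x y z x' y' z' ->
  forall s t, 0 <= s <= mdist x y -> 0 <= t <= mdist x z ->
    mdist (c s) (c' t) <=
      edist (comparison_point x' y' (mdist x y) s)
            (comparison_point x' z' (mdist x z) t).

Definition hadamard_space :=
  [/\ complete_space, geodesic_space & cat0_inequality].

(* Euclidean law of cosines: the angle at the vertex corresponding to x in a
   comparison triangle for p, x, q. *)
Definition comparison_angle (p x q : X) : R :=
  acos ((mdist x p ^+ 2 + mdist x q ^+ 2 - mdist p q ^+ 2)
        / (2 * mdist x p * mdist x q)).

(* The limsup is taken in \bar R; [fine] loses nothing since comparison angles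
   lie in [0, pi]. *)
Definition alexandrov_angle x c c' : R :=
  fine (limf_esup
    (fun p : R * R => (comparison_angle (c p.1) x (c' p.2))%:E)
    (filter_prod (0 : R)^'+ (0 : R)^'+)).

(* A chosen geodesic from x to y; in a Hadamard space there is exactly one, up
   to its values outside [0, d(x, y)]. *)
Definition geod x y : R -> X :=
  xget (cst x : {classic (R -> X)}) [set c | geodesic c x y].

Definition angle a x y : R := alexandrov_angle x (geod x a) (geod x y).

(* The minimum over a in A is a real number as soon as A is nonempty. *)
Definition min_cos (A : {fset X}) x y : \bar R :=
  \big[mine/+oo%E]_(a <- A) (mdist a x * cos (angle a x y))%:E.

Definition sup_min_cos (A : {fset X}) x : \bar R :=
  ereal_sup [set min_cos A x y | y in [set y | y != x]].

Definition mean_deficit (A : {fset X}) x : \bar R :=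
  maxe (sup_min_cos A x) 0%E.

Definition local_minimizer (f : X -> R) x := \forall y \near x, f x <= f y.

Definition slope (f : X -> R) x : \bar R :=
  if `[< local_minimizer f x >] then 0%E
  else limf_esup (fun y => ((f x - f y) / mdist x y)%:E) x^'.

(* The maximum is that of finitely many real numbers, so [fine] loses nothing
   when A is nonempty. *)
Definition max_fun (A : {fset X}) (xbar x : X) : R :=
  2^-1 * fine (\big[maxe/-oo%E]_(a <- A)
                 (mdist a x ^+ 2 - mdist a xbar ^+ 2)%:E).

Definition local_geodesic c (alpha beta : R) :=
  forall t, alpha <= t <= beta ->
  exists2 delta : R, 0 < delta &
    forall s s', alpha <= s <= beta -> alpha <= s' <= beta ->
      `|s - t| < delta -> `|s' - t| < delta ->
      mdist (c s) (c s') = `|s - s'|.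

Definition geodesic_extension_property :=
  forall c (alpha beta : R), alpha < beta -> local_geodesic c alpha beta ->
  exists2 eps : R, 0 < eps &
    exists2 c', local_geodesic c' alpha (beta + eps) &
      forall t, alpha <= t <= beta -> c' t = c t.

End Hadamard.

Arguments complete_space {R} X.
Arguments geodesic_space {R} X.
Arguments cat0_inequality {R} X.
Arguments hadamard_space {R} X.
Arguments geodesic_extension_property {R} X.

(* Main.v *)
(* The CAT(0) inequality is the law of cosines as an inequality, so the cosine
   of the comparison angle at x is monotone along geodesics and
   cos (angle a x y) is its supremum.  This yields the first variation formula:
   along the geodesic c from x to y, the quotients
   F(t) = (d(a,x)^2 - d(a,c(t))^2) / (2 t) tend to
   D(a,y) = d(a,x) cos (angle a x y) as t -> 0, and F(t) <= D(a,y) - t/2.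
   The limit gives slope >= deficit; the inequality at t = d(x,y) gives the
   reverse one, without local compactness or geodesic extension.
   For attainment, D(a,y) depends only on the germ of c at x and is Lipschitz
   in y on spheres around x.  A furthest point z of a compact ball among those
   with y on the geodesic from x to z lies on the bounding sphere, since
   otherwise a local geodesic extension beyond z would be a geodesic, by CAT(0).
   So the supremum can be taken over a compact sphere. *)
From mathcomp Require Import ring lra.
Require Import Defs.

Set Implicit Arguments.
Unset Strict Implicit.
Unset Printing Implicit Defensive.

Local Open Scope classical_set_scope.
Local Open Scope ring_scope.

Section Cat0.
Context {R : realType} {X : metricType R}.
Implicit Types (c : R -> X) (x y z a : X) (r s t : R).

(** * Comparison triangles in the plane and the law of cosines *)

Lemma edistE (p q : 'rV[R]_2) :
  edist p q = Num.sqrt ((p 0 0 - q 0 0) ^+ 2 + (p 0 1 - q 0 1) ^+ 2).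
Proof.
rewrite /edist !big_ord_recl big_ord0 addr0 (_ : lift _ _ = 1)//.
exact: val_inj.
Qed.

Lemma edist_sqr (p q : 'rV[R]_2) :
  edist p q ^+ 2 = (p 0 0 - q 0 0) ^+ 2 + (p 0 1 - q 0 1) ^+ 2.
Proof. by rewrite edistE sqr_sqrtr// addr_ge0 ?sqr_ge0. Qed.

Definition vec2 (u v : R) : 'rV[R]_2 := \row_i (if i == 0 then u else v).

Lemma vec2E u v : (vec2 u v 0 0 = u) * (vec2 u v 0 1 = v).
Proof. by rewrite !mxE. Qed.

Lemma eq_edist (p q : 'rV[R]_2) r : 0 <= r ->
  (p 0 0 - q 0 0) ^+ 2 + (p 0 1 - q 0 1) ^+ 2 = r ^+ 2 -> edist p q = r.
Proof. by move=> r0; rewrite edistE => ->; rewrite sqrtr_sqr ger0_norm. Qed.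

(* The cosine of the angle between the sides p and q facing the side d. *)
Definition cos_bar (p q d : R) : R := (p ^+ 2 + q ^+ 2 - d ^+ 2) / (2 * p * q).

Lemma cos_bar_bounded p q d : 0 < p -> 0 < q -> d <= p + q -> `|p - q| <= d ->
  -1 <= cos_bar p q d <= 1.
Proof.
move=> p0 q0 dpq; rewrite ler_norml /cos_bar => /andP[h1 h2].
have pq0 : 0 < 2 * p * q by rewrite !mulr_gt0.
by rewrite ler_pdivlMr// ler_pdivrMr//; apply/andP; split; nra.
Qed.

Lemma cos_bar_triangle x y z : x != y -> x != z ->
  -1 <= cos_bar (mdist x y) (mdist x z) (mdist y z) <= 1.
Proof.
move=> xy xz; apply: cos_bar_bounded; rewrite ?mdist_gt0//.
  by rewrite (metric_sym x y) metric_triangle.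
have := metric_triangle x y z; have := metric_triangle x z y.
by rewrite ler_norml (metric_sym z y) => h1 h2; apply/andP; split; lra.
Qed.

(** The comparison triangle is placed with [x'] at the origin, [y'] on the first axis and [z'] in
    the direction [(k, v)], where [k] and [v] are the cosine and sine of its angle at [x']. The
    right-hand side is then the squared distance between the comparison points of [c s] and
    [c' t]. *)
Lemma cat0_law_of_cosines x y z c c' s t : cat0_inequality X ->
  geodesic c x y -> geodesic c' x z -> x != y -> x != z ->
  0 <= s <= mdist x y -> 0 <= t <= mdist x z ->
  mdist (c s) (c' t) ^+ 2 <=
  s ^+ 2 + t ^+ 2 - 2 * s * t * cos_bar (mdist x y) (mdist x z) (mdist y z).
Proof.
move=> cat0 cxy cxz xy xz hs ht; set k := cos_bar _ _ _.
have /andP[k1 k2] : -1 <= k <= 1 by exact: cos_bar_triangle.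
set p := mdist x y in hs k k1 k2 *; set q := mdist x z in ht k k1 k2 *.
set d := mdist y z in k k1 k2 *.
have p0 : 0 < p by rewrite mdist_gt0.
have q0 : 0 < q by rewrite mdist_gt0.
have kE : 2 * p * q * k = p ^+ 2 + q ^+ 2 - d ^+ 2.
  by rewrite /k /cos_bar mulrC divfK// !mulf_neq0// gt_eqF.
clearbody k; pose v := Num.sqrt (1 - k ^+ 2).
have vE : v ^+ 2 = 1 - k ^+ 2 by rewrite sqr_sqrtr//; nra.
clearbody v.
pose x' := vec2 0 0; pose y' := vec2 p 0; pose z' := vec2 (q * k) (q * v).
have T : comparison_triangle x y z x' y' z'.
  split; apply: eq_edist; rewrite ?mdist_ge0// !vec2E.
  - by rewrite -/p; ring.
  - rewrite -/q; transitivity (q ^+ 2 * (k ^+ 2 + v ^+ 2)); first ring.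
    by rewrite vE; ring.
  - rewrite sub0r sqrrN -/d.
    transitivity (p ^+ 2 - 2 * p * q * k + q ^+ 2 * (k ^+ 2 + v ^+ 2)); first ring.
    by rewrite vE kE; ring.
have := cat0 x y z c c' cxy cxz x' y' z' T s t hs ht.
have sp : s / p * p = s by rewrite divfK// gt_eqF.
have tq : t / q * q = t by rewrite divfK// gt_eqF.
move=> h; have {h} : mdist (c s) (c' t) ^+ 2 <=
    edist (comparison_point x' y' p s) (comparison_point x' z' q t) ^+ 2.
  by rewrite ler_sqr// ?nnegrE ?mdist_ge0// sqrtr_ge0.
rewrite edist_sqr /comparison_point !mxE !subr0 !add0r mulr0 sp !mulrA tq.
suff -> : (s - t * k) ^+ 2 + (0 - t * v) ^+ 2 =
  s ^+ 2 + t ^+ 2 - 2 * s * t * k by [].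
transitivity (s ^+ 2 - 2 * s * t * k + t ^+ 2 * (k ^+ 2 + v ^+ 2)); first ring.
by rewrite vE; ring.
Qed.

(** * Elementary facts on geodesics *)

Lemma geodesic_dist c x y s : geodesic c x y -> 0 <= s <= mdist x y ->
  mdist x (c s) = s.
Proof.
case=> <- _ h hs; rewrite h ?lexx ?mdist_ge0//= sub0r normrN ger0_norm//.
by case/andP: hs.
Qed.

Lemma geodesic_prefix c x y s : geodesic c x y -> 0 <= s <= mdist x y ->
  geodesic c x (c s).
Proof.
move=> cxy hs; have sE := geodesic_dist cxy hs; case: (cxy) => c0 _ h.
split=> //; first by rewrite sE.
by rewrite sE => u v hu hv; apply: h; lra.
Qed.

Lemma geodesic_neq c x y s : geodesic c x y -> 0 < s <= mdist x y -> x != c s.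
Proof.
move=> cxy hs; have hs' : 0 <= s <= mdist x y by lra.
by rewrite -mdist_gt0 (geodesic_dist cxy hs'); case/andP: hs.
Qed.

Lemma geodP x y : geodesic_space X -> geodesic (geod x y) x y.
Proof.
move=> g; apply: (@xgetPex {classic (R -> X)} _ [set c | geodesic c x y]).
exact: g.
Qed.

(** * The Alexandrov angle as a monotone limit of comparison angles *)

Section TwoGeodesics.
Variables (x a y : X) (c c' : R -> X).
Hypotheses (cat0 : cat0_inequality X).
Hypotheses (cxa : geodesic c x a) (cxy : geodesic c' x y).
Hypotheses (xa : x != a) (xy : x != y).
Let l := mdist x a.
Let r := mdist x y.
Let q s t := cos_bar s t (mdist (c s) (c' t)).
Let l0 : 0 < l. Proof. by rewrite mdist_gt0. Qed.
Let r0 : 0 < r. Proof. by rewrite mdist_gt0. Qed.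

Let cosE s t : 0 < s <= l -> 0 < t <= r ->
  cos_bar (mdist x (c s)) (mdist x (c' t)) (mdist (c s) (c' t)) = q s t.
Proof.
move=> hs ht; rewrite (geodesic_dist cxa) ?(geodesic_dist cxy)//.
  by rewrite -/r; lra.
by rewrite -/l; lra.
Qed.

Let q_bounded s t : 0 < s <= l -> 0 < t <= r -> -1 <= q s t <= 1.
Proof.
move=> hs ht; rewrite -cosE//; apply: cos_bar_triangle.
  exact: geodesic_neq cxa _.
exact: geodesic_neq cxy _.
Qed.

(** Prefixes of geodesics are geodesics, so the law of cosines applies to the triangle [x], [c S],
    [c' T]; solved for the cosine, it is this inequality. *)
Let q_antitone s t S T : 0 < s <= S -> S <= l -> 0 < t <= T -> T <= r ->
  q S T <= q s t.
Proof.
move=> hs hS ht hT.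
have HS : 0 < S <= l by lra.
have HT : 0 < T <= r by lra.
have gS : geodesic c x (c S) by apply: geodesic_prefix cxa _; rewrite -/l; lra.
have gT : geodesic c' x (c' T) by apply: geodesic_prefix cxy _; rewrite -/r; lra.
have := cat0_law_of_cosines cat0 gS gT (geodesic_neq cxa HS) (geodesic_neq cxy HT).
move=> /(_ s t).
rewrite cosE// (geodesic_dist cxa) ?(geodesic_dist cxy) -/l -/r; [|lra..].
move=> /(_ ltac:(lra) ltac:(lra)) h.
have st0 : 0 < 2 * s * t by rewrite !mulr_gt0//; lra.
rewrite /q /cos_bar in h *; rewrite ler_pdivlMr//.
by rewrite -/(cos_bar S T (mdist (c S) (c' T))) in h *; lra.
Qed.

Let comparison_angleE s t : 0 < s <= l -> 0 < t <= r ->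
  comparison_angle (c s) x (c' t) = acos (q s t).
Proof. by move=> hs ht; rewrite -cosE. Qed.

Let L := limf_esup (fun p : R * R => (comparison_angle (c p.1) x (c' p.2))%:E)
    (filter_prod (0 : R)^'+ (0 : R)^'+).

(** The limsup is at most the supremum over the box of pairs [(u, v)] with [0 < u <= s] and
    [0 < v <= t]. There [q u v >= q s t], and [acos] reverses the order. *)
Let L_le s t : 0 < s <= l -> 0 < t <= r -> (L <= (acos (q s t))%:E)%E.
Proof.
move=> hs ht; apply: (@le_trans _ _ (ereal_sup
    [set (comparison_angle (c p.1) x (c' p.2))%:E |
      p in [set u | 0 < u <= s] `*` [set u | 0 < u <= t]])).
  apply: ereal_inf_lbound => /=; eexists; last reflexivity.
  exists ([set u | 0 < u <= s], [set u | 0 < u <= t]) => //=; split.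
    near=> u; apply/andP; split; near: u; first exact: nbhs_right_gt.
    by apply: nbhs_right_le; case/andP: hs.
  near=> u; apply/andP; split; near: u; first exact: nbhs_right_gt.
  by apply: nbhs_right_le; case/andP: ht.
apply: ge_ereal_sup => _ [[u v] /= [hu hv] <-].
rewrite lee_fin comparison_angleE; [|lra..].
have qs : -1 <= q s t <= 1 by exact: q_bounded.
have qu : -1 <= q u v <= 1 by apply: q_bounded; lra.
rewrite leNgt -ltr_cos ?in_itv/= ?acos_ge0 ?acos_lepi//.
by rewrite !acosK ?in_itv//= -leNgt; apply: q_antitone => //; lra.
Unshelve. all: by end_near. Qed.

Let L_ge b : (forall s t, 0 < s <= l -> 0 < t <= r -> b <= acos (q s t)) ->
  (b%:E <= L)%E.
Proof.
move=> hb; apply: le_ereal_inf_tmp => _ [V [[P Q] /= [hP hQ] PQV] <-].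
have [s [Ps hs]] : exists s, P s /\ 0 < s <= l.
  apply: (@filter_ex _ (0 : R)^'+); near=> s; split; first by near: s.
  by apply/andP; split; near: s; [exact: nbhs_right_gt|exact: nbhs_right_le].
have [t [Qt ht]] : exists t, Q t /\ 0 < t <= r.
  apply: (@filter_ex _ (0 : R)^'+); near=> t; split; first by near: t.
  by apply/andP; split; near: t; [exact: nbhs_right_gt|exact: nbhs_right_le].
apply: (@le_trans _ _ (comparison_angle (c s) x (c' t))%:E).
  by rewrite comparison_angleE// lee_fin hb.
by apply: ereal_sup_ubound; exists (s, t) => //; exact: PQV.
Unshelve. all: by end_near. Qed.

(** The bounds exclude infinite values of [L], so [fine] in [alexandrov_angle] loses nothing. *)
Let angle_def : L = (alexandrov_angle x c c')%:E /\
  0 <= alexandrov_angle x c c' <= pi.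
Proof.
have hl : 0 < l <= l by rewrite l0 lexx.
have hr : 0 < r <= r by rewrite r0 lexx.
have h0 : (0%:E <= L)%E by apply: L_ge => s t hs ht; rewrite acos_ge0// q_bounded.
have h1 : (L <= pi%:E)%E.
  by apply: le_trans (L_le hl hr) _; rewrite lee_fin acos_lepi// q_bounded.
rewrite /alexandrov_angle -/L.
by move: h0 h1; case: L => [u| |]//=; rewrite !lee_fin => -> ->.
Qed.

Lemma cos_bar_le_cos_angle s t : 0 < s <= l -> 0 < t <= r ->
  cos_bar s t (mdist (c s) (c' t)) <= cos (alexandrov_angle x c c').
Proof.
move=> hs ht; have [LE hA] := angle_def.
have := L_le hs ht; rewrite LE lee_fin => h.
have qs : -1 <= q s t <= 1 by exact: q_bounded.
rewrite -/(q s t) -[q s t]acosK ?in_itv// leNgt ltr_cos ?in_itv//= -?leNgt//.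
by rewrite acos_ge0 ?acos_lepi.
Qed.

(** Together with [cos_bar_le_cos_angle], this makes the cosine of the angle the supremum of [q]. By
    monotonicity [s] can stay fixed while [u] shrinks, which is what the first variation formula
    requires. *)
Lemma cos_angle_approx e : 0 < e ->
  exists s t, [/\ 0 < s <= l, 0 < t <= r & forall u, 0 < u <= t ->
    cos (alexandrov_angle x c c') - e < cos_bar s u (mdist (c s) (c' u))].
Proof.
move=> e0; apply: contrapT => H; have [LE hA] := angle_def.
set C := cos _ in H *.
have {}H s t : 0 < s <= l -> 0 < t <= r -> q s t <= C - e.
  move=> hs ht; rewrite leNgt; apply/negP => h; apply: H.
  exists s, t; split=> // u hu.
  by apply: lt_le_trans h _; apply: q_antitone; lra.
have hl : 0 < l <= l by rewrite l0 lexx.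
have hr : 0 < r <= r by rewrite r0 lexx.
have C1 : C <= 1 by exact: cos_le1.
(* The bound [H] at [s = l], [t = r] keeps [C - e] above -1, so that [acos] can be inverted
   there. *)
have KB : -1 <= C - e <= 1.
  by have := H _ _ hl hr; have := q_bounded hl hr; lra.
have : (((acos (C - e))%:E : \bar R) <= L)%E.
  apply: L_ge => s t hs ht; have qs := q_bounded hs ht.
  have {}H := H _ _ hs ht.
  rewrite leNgt -ltr_cos ?in_itv/= ?acos_ge0 ?acos_lepi//.
  by rewrite !acosK ?in_itv//= -leNgt.
rewrite LE lee_fin leNgt -ltr_cos ?in_itv/= ?acos_ge0 ?acos_lepi//.
by rewrite acosK ?in_itv//= -/C -leNgt; lra.
Qed.

End TwoGeodesics.

(** * The first variation formula *)

(** This is [cos_bar_le_cos_angle] at [s = d(x, a)], where the geodesic to [a] has reached [a],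
    multiplied by [d(x, a)]. *)
Lemma first_variation_le a x y t : hadamard_space X -> x != a -> x != y ->
  0 < t <= mdist x y ->
  (mdist a x ^+ 2 - mdist a (geod x y t) ^+ 2) / (2 * t) <=
  mdist a x * cos (angle a x y) - t / 2.
Proof.
move=> [_ gs cat0] xa xy ht; have l0 : 0 < mdist x a by rewrite mdist_gt0.
have hl : 0 < mdist x a <= mdist x a by rewrite l0 lexx.
have := cos_bar_le_cos_angle cat0 (geodP x a gs) (geodP x y gs) xa xy hl ht.
have [_ -> _] := geodP x a gs; rewrite -/(angle a x y) (metric_sym a x).
set l := mdist x a in l0 *; set C := cos _; set d := mdist a _.
have lt0 : 0 < 2 * l * t by rewrite !mulr_gt0//; lra.
by rewrite /cos_bar ler_pdivrMr// ler_pdivrMr; lra.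
Qed.

(** The approximation of the cosine is available only at some point [c1] of the segment from [x] to
    [a]. The triangle inequality through [c1] gives [l - D >= s - d1] and so carries the estimate
    over to [a], with errors quadratic in [t]. *)
Lemma first_variation_ge a x y e : hadamard_space X -> x != a -> x != y ->
  0 < e -> exists2 d, 0 < d & forall t, 0 < t <= d -> t <= mdist x y /\
  mdist a x * cos (angle a x y) - e <=
  (mdist a x ^+ 2 - mdist a (geod x y t) ^+ 2) / (2 * t).
Proof.
move=> [_ gs cat0] xa xy e0; have l0 : 0 < mdist x a by rewrite mdist_gt0.
rewrite (metric_sym a x).
have e'0 : 0 < e / (2 * mdist x a) by rewrite divr_gt0 ?mulr_gt0.
have [s [t0 [hs ht0]]] :=
  cos_angle_approx cat0 (geodP x a gs) (geodP x y gs) xa xy e'0.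
rewrite -/(angle a x y); set C := cos _; set l := mdist x a in l0 e'0 hs *.
move=> H; have s0 : 0 < s by case/andP: hs.
have k0 : 0 < l / s + 1 by rewrite addr_gt0// divr_gt0.
(* The quadratic errors add up to [(l / s + 1) * t ^+ 2], which this choice bounds by [e * t]. The
   tolerance [e / (2 * l)] on the cosine costs another [e * t]. *)
exists (Num.min t0 (e / (l / s + 1))).
  by rewrite lt_min divr_gt0//; case/andP: ht0 => ->.
move=> t /andP[t1]; rewrite le_min ler_pdivlMr// => /andP[tt0 te].
split; first lra.
have {H} := H t ltac:(lra).
have ce : e / (2 * l) * l = e / 2 by rewrite invfM mulrA divfK// gt_eqF.
set c1 := geod x a s; set c2 := geod x y t.
have h1 : mdist x c1 = s by apply: geodesic_dist (geodP x a gs) _; rewrite -/l; lra.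
have h2 : mdist x c2 = t by apply: geodesic_dist (geodP x y gs) _; lra.
have h3 : mdist c1 a = l - s.
  have [_ cE h] := geodP x a gs.
  by rewrite -[in LHS]cE /c1 h -/l ?ler0_norm; lra.
set e1 : R := e / (2 * l) in ce e'0 *.
have st0 : 0 < 2 * s * t by rewrite !mulr_gt0.
rewrite /cos_bar ltr_pdivlMr// => H.
have := metric_triangle a c1 c2; rewrite (metric_sym a c1) h3 => h4.
have := metric_triangle c1 x c2; rewrite (metric_sym c1 x) h1 h2 => h5.
have := metric_triangle x c2 c1; rewrite (metric_sym c2 c1) h1 h2 => h6.
have := metric_triangle a x c2; rewrite (metric_sym a x) -/l h2 => h7.
have := metric_triangle x c2 a; rewrite (metric_sym c2 a) -/l h2 => h8.
move: H h4 h5 h6 h7 h8; set d1 := mdist c1 c2; set D := mdist a c2.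
move=> H h4 h5 h6 h7 h8.
rewrite ler_pdivlMr; last lra.
set w : R := l / s in k0 te; have ws : w * s = l by rewrite divfK// gt_eqF.
(* Both differences of squares are linearised: [s ^+ 2 - d1 ^+ 2] is at most [2 * s * (s - d1)], and
   [l ^+ 2 - D ^+ 2] is at least [2 * l * (l - D) - t ^+ 2]. The factor [w = l / s] converts one
   linear term into the other. *)
have A1 : (s - d1) ^+ 2 >= 0 by exact: sqr_ge0.
have A2 : (l - D) ^+ 2 <= t ^+ 2 by nra.
have A0 : (s - d1) * (2 * s) <= (l - D) * (2 * s) by rewrite ler_wpM2r; lra.
have A3 : t * (C - e1) * (2 * s) <= (l - D) * (2 * s) + t ^+ 2.
  by move: H A0 A1; lra.
have w0 : 0 <= w by rewrite divr_ge0 ?ltW.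
clearbody C e1 d1 D w l.
have A4 : t * (C - e1) * (2 * l) <= (l - D) * (2 * l) + w * t ^+ 2.
  have := ler_wpM2l w0 A3.
  have -> : w * (t * (C - e1) * (2 * s)) = t * (C - e1) * (2 * (w * s)) by ring.
  have -> : w * ((l - D) * (2 * s) + t ^+ 2) =
    (l - D) * (2 * (w * s)) + w * t ^+ 2 by ring.
  by rewrite ws.
have A5 := ler_wpM2l (ltW t1) te.
have A6 : t * (e1 * l) = t * (e / 2) by rewrite ce.
by move: A2 A4 A5 A6; lra.
Qed.

(** * Dependence of the directional derivative on the direction *)

(** The difference quotients along the two geodesics are compared at one small [t]: the distances to
    [a] differ by at most [k * t], so the quotients differ by at most [k * (l + t)]. *)
Lemma directional_derivative_lipschitz a x y z k : hadamard_space X ->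
  x != a -> x != y -> x != z -> 0 <= k ->
  (forall t, 0 < t <= mdist x y -> t <= mdist x z ->
    mdist (geod x y t) (geod x z t) <= k * t) ->
  mdist a x * cos (angle a x y) <=
  mdist a x * cos (angle a x z) + mdist a x * k.
Proof.
move=> hX xa xy xz k0 hk; apply/ler_addgt0Pr => e e0.
have e2 : 0 < e / 2 by rewrite divr_gt0.
have [d d0 H] := first_variation_ge hX xa xy e2.
have [_ gs _] := hX.
have r0 : 0 < mdist x y by rewrite mdist_gt0.
have r'0 : 0 < mdist x z by rewrite mdist_gt0.
have k1 : 0 < k + 1 by lra.
(* The last bound makes the surplus [k * t] at most [e / 2]; dividing by [k + 1] also covers
   [k = 0]. *)
pose t := Num.min d (Num.min (mdist x z) (e / 2 / (k + 1))).
have /and3P[t1 t2 t3] : [&& t <= d, t <= mdist x z & t <= e / 2 / (k + 1)].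
  by rewrite -!le_min.
have t0 : 0 < t by rewrite !lt_min d0 r'0 divr_gt0.
rewrite ler_pdivlMr// in t3.
clearbody t; have [ty hy] := H t ltac:(lra).
have hz := first_variation_le hX xa xz (t := t) ltac:(lra).
have hw := hk t ltac:(lra) t2.
have lz : mdist x (geod x z t) = t by apply: geodesic_dist (geodP x z gs) _; lra.
have ly : mdist x (geod x y t) = t by apply: geodesic_dist (geodP x y gs) _; lra.
move: hy hz hw lz ly; set cy := geod x y t; set cz := geod x z t.
move=> hy hz hw lz ly.
have := metric_triangle a cy cz; have := metric_triangle a x cz.
have := metric_triangle a x cy; rewrite lz ly => h1 h2 h3.
set l := mdist a x in h1 h2 hy hz *.
have [l0 u0 v0] : [/\ 0 <= l, 0 <= mdist a cy & 0 <= mdist a cz].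
  by rewrite !mdist_ge0.
move: h1 h2 h3 hy hz hw u0 v0.
set v := mdist a cy; set u := mdist a cz; set w := mdist cy cz.
move=> h1 h2 h3 hy hz hw u0 v0.
have B : u ^+ 2 - v ^+ 2 <= k * t * (2 * l + 2 * t).
  have B0 : 0 <= k * t by rewrite mulr_ge0// ltW.
  have B1 : u - v <= k * t by lra.
  have [uv|uv] := lerP u v.
    apply: (@le_trans _ _ 0); first by rewrite subr_le0 ler_sqr.
    by rewrite mulr_ge0//; lra.
  rewrite subr_sqr ler_pM//; first by rewrite subr_ge0 ltW.
    exact: addr_ge0.
  by move: h1 h2; clear; lra.
have B' : (l ^+ 2 - v ^+ 2) / (2 * t) - (l ^+ 2 - u ^+ 2) / (2 * t) <=
    k * (l + t).
  rewrite -mulrBl ler_pdivrMr ?mulr_gt0//.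
  by move: B; clear; lra.
by move: hy hz B' t3 t0; lra.
Qed.

(** On a sphere the law of cosines with equal parameters reduces to
    [d(c t, c' t) <= (t / r) * d(y, z)], so [k] can be [d(y, z) / r]. *)
Lemma directional_derivative_sphere a x y z r : hadamard_space X ->
  x != a -> 0 < r -> mdist x y = r -> mdist x z = r ->
  mdist a x * cos (angle a x y) <=
  mdist a x * cos (angle a x z) + mdist a x * (mdist y z / r).
Proof.
move=> hX xa r0 yr zr; have [_ gs cat0] := hX.
have xy : x != y by rewrite -mdist_gt0 yr.
have xz : x != z by rewrite -mdist_gt0 zr.
apply: directional_derivative_lipschitz => //.
  by rewrite divr_ge0 ?mdist_ge0 ?ltW.
move=> t ht htz; rewrite -ler_sqr ?nnegrE ?mdist_ge0//; last first.
  by rewrite !mulr_ge0 ?invr_ge0 ?mdist_ge0//; lra.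
have ht1 : 0 <= t <= mdist x y by lra.
have ht2 : 0 <= t <= mdist x z by lra.
apply: le_trans (cat0_law_of_cosines cat0 (geodP x y gs) (geodP x z gs) xy xz
  ht1 ht2) _.
rewrite yr zr /cos_bar le_eqVlt; apply/orP; left; apply/eqP.
by field; rewrite gt_eqF.
Qed.

(** The comparison triangle is degenerate with angle 0 at [x], and the law of cosines bounds the
    squared distance by [(t - t) ^+ 2]. *)
Lemma geodesic_collinear c c' x y z t : cat0_inequality X -> x != y ->
  geodesic c x y -> geodesic c' x z ->
  mdist x z = mdist x y + mdist y z -> 0 <= t <= mdist x y -> c t = c' t.
Proof.
move=> cat0 xy cxy cxz E ht; apply: mdist_positivity.
have p0 : 0 < mdist x y by rewrite mdist_gt0.
have q0 := mdist_ge0 y z.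
have xz : x != z by rewrite -mdist_gt0 E; lra.
have ht' : 0 <= t <= mdist x z by rewrite E; lra.
have := cat0_law_of_cosines cat0 cxy cxz xy xz ht ht'.
rewrite (_ : cos_bar _ _ _ = 1); last first.
  by rewrite /cos_bar E; field; rewrite !gt_eqF//; lra.
rewrite mulr1 (_ : _ - _ = 0); last by ring.
by move=> h; apply/eqP; rewrite -(@sqrf_eq0 R) eq_le h sqr_ge0.
Qed.

(** The two geodesics share an initial segment, so the Lipschitz estimate holds with [k = 0] in both
    directions. *)
Lemma directional_derivative_extend a x y z : hadamard_space X ->
  x != a -> x != y -> mdist x z = mdist x y + mdist y z ->
  mdist a x * cos (angle a x y) = mdist a x * cos (angle a x z).
Proof.
move=> hX xa xy E; have [_ gs cat0] := hX.
have p0 : 0 < mdist x y by rewrite mdist_gt0.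
have q0 := mdist_ge0 y z.
have xz : x != z by rewrite -mdist_gt0 E; lra.
have same t : 0 < t <= mdist x y -> geod x y t = geod x z t.
  move=> ht; apply: geodesic_collinear (geodP x y gs) (geodP x z gs) E _ => //.
  by lra.
apply/eqP; rewrite eq_le; apply/andP; split.
  rewrite -[leRHS]addr0 -(mulr0 (mdist a x)).
  apply: directional_derivative_lipschitz => // t ht _.
  by rewrite same// mdistxx mul0r.
rewrite -[leRHS]addr0 -(mulr0 (mdist a x)).
apply: directional_derivative_lipschitz => // t ht ht'.
by rewrite same ?mdistxx ?mul0r//; lra.
Qed.

(** * Finite minima and maxima *)

Lemma bigmin_attained (I : eqType) (s : seq I) (g : I -> R) : s != [::] ->
  exists2 i, i \in s & \big[mine/+oo%E]_(j <- s) (g j)%:E = (g i)%:E /\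
    forall j, j \in s -> g i <= g j.
Proof.
elim: s => // i [|k s] IH _.
  exists i; rewrite ?inE// big_cons big_nil; split; first by rewrite minEle leey.
  by move=> j; rewrite inE => /eqP ->.
have [//|m ms [E mle]] := IH; rewrite big_cons E -EFin_min.
have [im|mi] := leP (g i) (g m).
  exists i; first by rewrite mem_head.
  by split=> // j; rewrite inE => /orP[/eqP ->|/mle]//; exact: le_trans.
exists m; first by rewrite inE ms orbT.
by split=> // j; rewrite inE => /orP[/eqP ->|/mle]//; exact: ltW.
Qed.

Lemma bigmax_attained (I : eqType) (s : seq I) (g : I -> R) : s != [::] ->
  exists2 i, i \in s & \big[maxe/-oo%E]_(j <- s) (g j)%:E = (g i)%:E /\
    forall j, j \in s -> g j <= g i.
Proof.
move=> /(bigmin_attained (fun i => - g i))[i si [E h]]; exists i => //; split.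
  rewrite -[RHS]oppeK -[X in (_ = - X)%E]/((- g i)%:E) -E.
  rewrite (big_morph _ oppe_min (erefl : - +oo = -oo)%E).
  by apply: eq_bigr => j _; rewrite EFinN oppeK.
by move=> j /h; rewrite lerN2.
Qed.

(** Makes the threshold of [first_variation_ge] uniform over the finite set. *)
Lemma small_forall_in (I : eqType) (s : seq I) (P : I -> R -> Prop) :
  (forall i, i \in s -> exists2 d, 0 < d & forall t, 0 < t <= d -> P i t) ->
  exists2 d, 0 < d & forall t, 0 < t <= d -> forall i, i \in s -> P i t.
Proof.
elim: s => [|i s IH] H; first by exists 1.
have [d d0 hd] : exists2 d, 0 < d & forall t, 0 < t <= d -> P i t.
  by apply: H; rewrite mem_head.
have [|d' d'0 hd'] := IH; first by move=> j js; apply: H; rewrite inE js orbT.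
exists (Num.min d d'); first by rewrite lt_min d0.
move=> t /andP[t0]; rewrite le_min => /andP[td td'] j.
by rewrite inE => /orP[/eqP ->|js]; [apply: hd|apply: hd' => //]; rewrite t0.
Qed.

(** * The slope equals the mean deficit *)

Section Slope.
Variables (A : {fset X}) (x : X).
Hypotheses (hX : hadamard_space X) (A0 : A != fset0) (xA : x \notin A).

Let A_seq0 : enum_fset A != [::].
Proof.
have /fset0Pn[a aA] := A0; apply/eqP => A0'.
by move: (aA : a \in enum_fset A); rewrite A0'.
Qed.

Let x_neq a : a \in A -> x != a.
Proof. by move=> aA; apply: contraNneq xA => ->. Qed.

Lemma min_cosE y : exists2 a, a \in A &
  min_cos A x y = (mdist a x * cos (angle a x y))%:E /\
  forall b, b \in A ->
    mdist a x * cos (angle a x y) <= mdist b x * cos (angle b x y).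
Proof. exact: (bigmin_attained _ A_seq0). Qed.

Lemma max_funE y : exists2 a, a \in A &
  max_fun A x y = (mdist a y ^+ 2 - mdist a x ^+ 2) / 2 /\
  forall b, b \in A -> (mdist b y ^+ 2 - mdist b x ^+ 2) / 2 <= max_fun A x y.
Proof.
have [a aA [E h]] :=
  bigmax_attained (fun a => mdist a y ^+ 2 - mdist a x ^+ 2) A_seq0.
exists a => //; rewrite /max_fun E/= mulrC; split=> // b /h.
by rewrite ler_pM2r.
Qed.

Lemma max_fun_center : max_fun A x x = 0.
Proof. by have [a _ [-> _]] := max_funE x; rewrite subrr mul0r. Qed.

(** The point of [A] realising the maximum varies with [t], hence the uniform threshold. Whichever
    [a] it is, its directional derivative is at least the minimum. *)
Lemma max_fun_descent y e : x != y -> 0 < e -> exists2 d, 0 < d &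
  forall t, 0 < t <= d -> t <= mdist x y /\
    (min_cos A x y - e%:E <=
      ((max_fun A x x - max_fun A x (geod x y t)) / t)%:E)%E.
Proof.
move=> xy e0; have [m mA [-> mle]] := min_cosE y.
have [|d d0 hd] := @small_forall_in _ (enum_fset A) (fun a t => t <= mdist x y /\
  mdist a x * cos (angle a x y) - e <=
  (mdist a x ^+ 2 - mdist a (geod x y t) ^+ 2) / (2 * t)).
  by move=> a aA; apply: first_variation_ge => //; exact: x_neq.
exists d => // t ht; split; first by have [] := hd t ht m mA.
rewrite -EFinB lee_fin max_fun_center.
have [a aA [-> _]] := max_funE (geod x y t).
have [_ h] := hd t ht a aA; have := mle a aA.
have -> : (0 - (mdist a (geod x y t) ^+ 2 - mdist a x ^+ 2) / 2) / t =
    (mdist a x ^+ 2 - mdist a (geod x y t) ^+ 2) / (2 * t).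
  by field; rewrite gt_eqF//; case/andP: ht.
by move: h; lra.
Qed.

(** For [a] minimising the directional derivative, [first_variation_le] at [t = d(x, y)] bounds the
    term of [a] alone, and the maximum is at least that term. *)
Lemma max_fun_slope_le y : x != y ->
  (((max_fun A x x - max_fun A x y) / mdist x y)%:E <= min_cos A x y)%E.
Proof.
move=> xy; have [a aA [-> _]] := min_cosE y; rewrite lee_fin max_fun_center.
have r0 : 0 < mdist x y by rewrite mdist_gt0.
have hr : 0 < mdist x y <= mdist x y by rewrite r0 lexx.
have := first_variation_le hX (x_neq aA) xy hr.
have [_ gs _] := hX; have [_ -> _] := geodP x y gs.
have [_ _ [_ /(_ a aA) h]] := max_funE y.
rewrite ler_pdivrMr; last lra.
move=> h'; rewrite sub0r ler_pdivrMr//.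
by have := sqr_ge0 (mdist x y); lra.
Qed.

Let f := max_fun A x.
Let limsup := limf_esup (fun y => ((f x - f y) / mdist x y)%:E) x^'.

(** The quotient bound is global, so the whole punctured space serves as the neighbourhood. *)
Let limsup_le : (limsup <= sup_min_cos A x)%E.
Proof.
apply: (@le_trans _ _ (ereal_sup
  [set ((f x - f y) / mdist x y)%:E | y in [set y | y != x]])).
  by apply: ereal_inf_lbound; exists [set y | y != x] => //; exact: withinT.
apply: ge_ereal_sup => _ [y /= yx <-].
apply: (@le_trans _ _ (min_cos A x y)); last first.
  by apply: ereal_sup_ubound; exists y.
by apply: max_fun_slope_le; rewrite eq_sym.
Qed.

(** Every punctured neighbourhood of [x] contains points of the geodesic towards [y], where
    [max_fun_descent] applies. *)
Let limsup_ge : (sup_min_cos A x <= limsup)%E.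
Proof.
have [_ gs _] := hX.
apply: ge_ereal_sup => _ [y /= yx <-]; rewrite eq_sym in yx.
apply: le_ereal_inf_tmp => _ [V /nbhs_ballP[r /= r0 rV] <-].
apply/lee_addgt0Pr => e e0.
have [d d0 H] := max_fun_descent yx e0.
pose t := Num.min d (r / 2).
have t0 : 0 < t by rewrite lt_min d0 divr_gt0.
have [ty] := H t ltac:(by rewrite t0 ge_min lexx).
rewrite leeBlDr// => /le_trans; apply; rewrite leeD2r//.
have tE : mdist x (geod x y t) = t.
  by apply: geodesic_dist (geodP x y gs) _; rewrite ltW.
apply: ereal_sup_ubound; exists (geod x y t); last by rewrite tE.
apply: rV; last by rewrite eq_sym -mdist_gt0 tE.
rewrite ballEmdist/= tE (@le_lt_trans _ _ (r / 2))//.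
  by rewrite ge_min lexx orbT.
by rewrite ltr_pdivrMr//; lra.
Qed.

Let local_min_sup : local_minimizer f x -> (sup_min_cos A x <= 0)%E.
Proof.
move=> /nbhs_ballP[r /= r0 hr]; have [_ gs _] := hX.
apply: ge_ereal_sup => _ [y /= yx <-]; rewrite eq_sym in yx.
apply/lee_addgt0Pr => e e0; rewrite add0e.
have [d d0 H] := max_fun_descent yx e0.
pose t := Num.min d (r / 2).
have t0 : 0 < t by rewrite lt_min d0 divr_gt0.
have [ty] := H t ltac:(by rewrite t0 ge_min lexx).
rewrite leeBlDr// => /le_trans; apply; rewrite geeDr// lee_fin.
have tE : mdist x (geod x y t) = t.
  by apply: geodesic_dist (geodP x y gs) _; rewrite ltW.
rewrite pmulr_lle0 ?invr_gt0// subr_le0; apply: hr.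
rewrite ballEmdist/= tE (@le_lt_trans _ _ (r / 2))//.
  by rewrite ge_min lexx orbT.
by rewrite ltr_pdivrMr//; lra.
Qed.

(** Settles the positive part of the deficit: off local minimizers, points with smaller values occur
    arbitrarily close to [x]. *)
Let limsup_ge0 : ~ local_minimizer f x -> (0 <= limsup)%E.
Proof.
move=> nmin; apply: le_ereal_inf_tmp => _ [V xV <-].
have [y [Vy yx fy]] : exists y, [/\ V y, y != x & f y < f x].
  apply: contrapT => H; apply: nmin.
  move/nbhs_ballP: xV => [r /= r0 rV]; apply/nbhs_ballP; exists r => // y xy /=.
  rewrite leNgt; apply/negP => fy; have yx : y != x.
    by apply: contraTneq fy => ->; rewrite ltxx.
  by apply: H; exists y; split=> //; exact: rV.
apply: (@le_trans _ _ ((f x - f y) / mdist x y)%:E).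
  by rewrite lee_fin divr_ge0 ?mdist_ge0// subr_ge0 ltW.
by apply: ereal_sup_ubound; exists y.
Qed.

Lemma slope_max_fun : slope (max_fun A x) x = mean_deficit A x.
Proof.
rewrite /slope /mean_deficit -/f; case: asboolP => hmin.
  by apply/esym/max_idPr/local_min_sup.
apply/eqP; rewrite eq_le le_max limsup_le/= ge_max limsup_ge/=.
exact: limsup_ge0.
Qed.

End Slope.

(** * Prolonging geodesics up to a sphere *)

(** The local extension is straight across [z]: its points at parameters [l - h] and [l + h] are
    [2 * h] apart. The law of cosines at [z] then forces the comparison cosine between [x] and [w]
    to be at most -1, that is, [d(x, w) >= l + h]. *)
Lemma local_extension x z e : hadamard_space X -> geodesic_extension_property X ->
  x != z -> 0 < e ->
  exists2 w, 0 < mdist z w <= e & mdist x w = mdist x z + mdist z w.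
Proof.
move=> [_ gs cat0] gep xz e0.
have cg := geodP x z gs; set c := geod x z in cg; have [c0 cz cd] := cg.
set l := mdist x z in cz cd *.
have l0 : 0 < l by rewrite mdist_gt0.
have lc : local_geodesic c 0 l.
  by move=> t _; exists 1 => // s s' hs hs' _ _; exact: cd.
have [eps eps0 [c' lc' c'E]] := gep c 0 l l0 lc.
have [|d d0 hd] := lc' l; first lra.
(* In order: [l + h] stays in the domain of [c'], [w] is within [e] of [z], both parameters lie in
   the window where [c'] is isometric, and [l - h >= 0]. *)
pose h := Num.min (Num.min eps e) (Num.min (d / 2) l).
have [h1 h2 h3 h4] : [/\ h <= eps, h <= e, h <= d / 2 & h <= l].
  by have := lexx h; rewrite {2}/h !le_min => /andP[/andP[-> ->] /andP[-> ->]].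
have h0 : 0 < h by rewrite !lt_min eps0 e0 l0 divr_gt0.
clearbody h; have hnd : h < d by lra.
have cl : c' l = z by rewrite c'E ?cz//; lra.
have d1 : mdist z (c' (l + h)) = h.
  by rewrite -cl hd ?ltr_norml; [rewrite ler0_norm; lra|lra..].
have d2 : mdist (c (l - h)) (c' (l + h)) = 2 * h.
  rewrite -(c'E (l - h)); last lra.
  by rewrite hd ?ltr_norml; [rewrite ler0_norm; lra|lra..].
set w := c' (l + h) in d1 d2; exists w; first by rewrite d1 h0.
have zw : z != w by rewrite -mdist_gt0 d1.
have zx : z != x by rewrite eq_sym.
have lE : mdist z x = l by rewrite metric_sym.
have grev : geodesic (fun s => c (l - s)) z x.
  split; rewrite ?lE ?subr0 ?subrr// => s t hs ht.
  by rewrite cd; [rewrite distrC; congr (`|_|); ring|lra..].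
have gw := geodP z w gs; have [_ wE _] := gw; rewrite d1 in wE.
have hz : 0 <= h <= mdist z x by rewrite lE; lra.
have hw : 0 <= h <= mdist z w by rewrite d1; lra.
have := cat0_law_of_cosines cat0 grev gw zx zw hz hw.
rewrite wE d2 lE d1 => H.
have D0 := mdist_ge0 x w; have Dle := metric_triangle x z w.
rewrite -/l d1 in Dle; apply/eqP; rewrite eq_le Dle/=.
have kle : cos_bar l h (mdist x w) <= -1.
  have hh0 : 0 < h ^+ 2 by rewrite exprn_gt0.
  by rewrite -(ler_pM2r hh0); lra.
move: kle; rewrite /cos_bar ler_pdivrMr; last by rewrite !mulr_gt0.
move=> kle; rewrite -ler_sqr ?nnegrE//; last lra.
by lra.
Qed.

Lemma mdist_continuous x : continuous (mdist x : X -> R).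
Proof.
move=> y; apply/cvgrPdist_lt => e e0; apply/nbhs_ballP; exists e => // z.
rewrite ballEmdist/= => yz; rewrite ltr_norml.
have := metric_triangle x y z; have := metric_triangle x z y.
by rewrite (metric_sym z y) => h1 h2; apply/andP; split; lra.
Qed.

Lemma extend_to_sphere x y r : hadamard_space X -> geodesic_extension_property X ->
  compact [set z | mdist x z <= r] -> x != y -> mdist x y <= r ->
  exists2 z, mdist x z = r & mdist x z = mdist x y + mdist y z.
Proof.
move=> hX gep cB xy yr.
(* By the triangle inequality the second condition says that [y] lies between [x] and [z]; as a weak
   inequality it is closed. *)
pose S := [set z | mdist x z <= r] `&` [set z | mdist x y <= mdist x z - mdist y z].
have cS : compact S.
  apply: subclosed_compact cB _; last exact: subIsetl.
  apply: closedI.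
    exact: (closed_comp (fun z _ => @mdist_continuous x z) (@closed_le _ r)).
  apply: (closed_comp _ (@closed_ge _ (mdist x y))) => z _.
  by apply: cvgB; exact: mdist_continuous.
have S0 : S !=set0 by exists y; split=> //=; rewrite mdistxx subr0.
have [z /set_mem[/= zr zy] zmax] :=
  compact_EVT_max S0 cS (continuous_subspaceT (@mdist_continuous x)).
have E : mdist x z = mdist x y + mdist y z.
  by have := metric_triangle x y z; lra.
exists z => //; apply/eqP; rewrite eq_le zr leNgt; apply/negP => zlt.
have xz : x != z.
  have p0 : 0 < mdist x y by rewrite mdist_gt0.
  by rewrite -mdist_gt0; have := mdist_ge0 y z; lra.
(* The allowance [r - d(x, z)] keeps the prolonged point in the ball, where it contradicts the
   maximality of [z]. *)
have [|w /andP[w0 we] wE] :=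
  local_extension hX gep xz (e := r - mdist x z); first lra.
have /zmax : w \in S.
  rewrite inE; split=> /=; first lra.
  by have := metric_triangle y z w; lra.
by rewrite wE; lra.
Qed.

Lemma compact_closed_ball x : locally_compact [set: X] ->
  exists2 r, 0 < r & compact [set z | mdist x z <= r].
Proof.
move=> /(_ x I) [U /nbhs_ballP[e /= e0 eU] [cU _]].
have e2 : 0 < e / 2 by rewrite divr_gt0.
exists (e / 2) => //; apply: subclosed_compact cU _.
  exact: (closed_comp (fun z _ => @mdist_continuous x z) (@closed_le _ (e / 2))).
by move=> z /= zr; apply: eU => //; rewrite ballEmdist/=; lra.
Qed.

(** * Attainment of the supremum *)

Section Attained.
Variables (A : {fset X}) (x : X).
Hypotheses (hX : hadamard_space X) (A0 : A != fset0) (xA : x \notin A).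

Let x_neq a : a \in A -> x != a.
Proof. by move=> aA; apply: contraNneq xA => ->. Qed.

Lemma min_cos_extend y z : x != y -> mdist x z = mdist x y + mdist y z ->
  min_cos A x y = min_cos A x z.
Proof.
move=> xy E; rewrite /min_cos; apply: eq_big_seq => a aA; congr (_%:E).
by apply: directional_derivative_extend => //; exact: x_neq.
Qed.

(** Each directional derivative has Lipschitz constant [d(a, x) / r] on the sphere; [K] is the
    largest of these. The minimum at [y] is compared through the minimiser [a] at [z]. *)
Lemma min_cos_lipschitz r : 0 < r -> exists2 K, 0 < K & forall y z,
  mdist x y = r -> mdist x z = r ->
  fine (min_cos A x y) <= fine (min_cos A x z) + K * mdist y z.
Proof.
move=> r0; have [m mA Mmax] : exists2 m, m \in A &
    forall a, a \in A -> mdist a x <= mdist m x.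
  have [|m mA [_ h]] := bigmax_attained (s := enum_fset A) (mdist ^~ x).
    have /fset0Pn[a aA] := A0; apply/eqP => A0'.
    by move: (aA : a \in enum_fset A); rewrite A0'.
  by exists m.
have m0 : 0 < mdist m x by rewrite metric_sym mdist_gt0 x_neq.
exists (mdist m x / r); first by rewrite divr_gt0.
move=> y z yr zr.
have [b _ [-> bmin]] := min_cosE x A0 y.
have [a aA [-> _]] := min_cosE x A0 z => /=.
apply: le_trans (bmin a aA) _.
apply: le_trans (directional_derivative_sphere hX (x_neq aA) r0 yr zr) _.
rewrite lerD2l mulrAC mulrA ler_pM2r ?invr_gt0// ler_wpM2r ?mdist_ge0//.
exact: Mmax.
Qed.

Lemma min_cos_attained : locally_compact [set: X] ->
  geodesic_extension_property X ->
  exists2 y, y != x & min_cos A x y = sup_min_cos A x.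
Proof.
move=> lc gep; have [_ gs _] := hX.
have [r r0 cB] := compact_closed_ball x lc.
pose S := [set z | mdist x z = r].
have cS : compact S.
  apply: subclosed_compact cB _; last by move=> z /= ->.
  exact: (closed_comp (fun z _ => @mdist_continuous x z) (@closed_eq _ r)).
(* A point inside the ball is pushed outwards along a prolongation, and a point outside is pulled
   back along its geodesic; neither changes [min_cos]. *)
have to_sphere y : x != y -> exists2 z, S z & min_cos A x y = min_cos A x z.
  move=> xy; have [yr|ry] := leP (mdist x y) r.
    have [z zr E] := extend_to_sphere hX gep cB xy yr.
    by exists z; [exact: zr|exact: min_cos_extend].
  have [_ yE h] := geodP x y gs.
  have zr : mdist x (geod x y r) = r.
    by apply: geodesic_dist (geodP x y gs) _; lra.
  exists (geod x y r); first exact: zr.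
  apply/esym/min_cos_extend.
    by rewrite -mdist_gt0 zr.
  have -> : mdist (geod x y r) y = mdist x y - r.
    by rewrite -[X in mdist (geod x y r) X]yE h; [rewrite ler0_norm; lra|lra..].
  by rewrite zr addrC subrK.
have S0 : S !=set0.
  have /fset0Pn[a aA] := A0.
  by have [z Sz _] := to_sphere a (x_neq aA); exists z.
have [K K0 hK] := min_cos_lipschitz r0.
have cf : {within S, continuous (fun y => fine (min_cos A x y))}.
  apply/subspace_continuousP => y Sy; apply/cvgrPdist_lt => e e0.
  apply/nbhs_ballP; exists (e / K); first by rewrite /= divr_gt0.
  move=> z; rewrite ballEmdist/= ltr_pdivlMr// mulrC => yz Sz.
  have := hK _ _ Sy Sz; have := hK _ _ Sz Sy; rewrite (metric_sym z y).
  rewrite /from_subspace ltr_distl ltrBlDr => h1 h2.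
  by rewrite (le_lt_trans h1) ?ltrD2l// (le_lt_trans h2) ?ltrD2l.
have [y /set_mem Sy ymax] := compact_EVT_max S0 cS cf.
have yx : y != x by rewrite eq_sym -mdist_gt0 Sy.
exists y => //; apply/eqP; rewrite eq_le; apply/andP; split.
  by apply: ereal_sup_ubound; exists y.
apply: ge_ereal_sup => _ [u /= ux <-]; rewrite eq_sym in ux.
have [z Sz ->] := to_sphere u ux.
have := ymax z (mem_set Sz).
have [b _ [-> _]] := min_cosE x A0 y.
by have [a _ [-> _]] := min_cosE x A0 z; rewrite lee_fin.
Qed.

End Attained.

End Cat0.

Theorem theorem7p6 (R : realType) (X : metricType R) (A : {fset X}) (xbar : X)
    (hX : hadamard_space X) (hA : A != fset0) (hxbar : xbar \notin A) :
  (mean_deficit A xbar <= slope (max_fun A xbar) xbar)%E /\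
  (locally_compact [set: X] -> geodesic_extension_property X ->
     slope (max_fun A xbar) xbar = mean_deficit A xbar /\
     exists2 y : X, y != xbar & min_cos A xbar y = sup_min_cos A xbar).
Proof.
rewrite slope_max_fun//; split=> // lc gep; split=> //.
exact: min_cos_attained.
Qed.
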